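(* In the definition of (commutative) $MVW$-rig, with axioms i), ii), iii) listed in the context, axiom iii) is independent of the other axioms; that is, there is an MV-algebra with an associative commutative product satisfying i) and ii) but not iii). Similarly, axiom i) is independent of the others: there is an MV-algebra with an associative commutative product satisfying ii) and iii) but not i).
   Context: An MV-algebra is $(A,\oplus,\neg,0)$ with $(A,\oplus,0)$ a commutative monoid, $\neg\neg x=x$, $x\oplus\neg 0=\neg 0$, $\neg(\neg x\oplus y)\oplus y=\neg(\neg y\oplus x)\oplus x$. Put $x\ominus y=\neg(\neg x\oplus y)$. An $MVW$-rig is an MV-algebra with an associative product (assumed commutative throughout) such that for all $a,b,c$: i) $a0=0a=0$; ii) $\big(a(b\oplus c)\big)\ominus(ab\oplus ac)=0$; iii) $(ab\ominus ac)\ominus\big(a(b\ominus c)\big)=0$. *)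

(* Defs.v *)
From mathcomp Require Import all_boot.

Set Implicit Arguments.
Unset Strict Implicit.
Unset Printing Implicit Defensive.

Declare Scope mv_scope.
Delimit Scope mv_scope with MV.

Record mvAlgebra := MVAlgebra {
  mv_sort :> Type;
  oplus : mv_sort -> mv_sort -> mv_sort;
  mvneg : mv_sort -> mv_sort;
  mv0 : mv_sort;
  oplusA : associative oplus;
  oplusC : commutative oplus;
  oplus0x : left_id mv0 oplus;
  mvnegK : involutive mvneg;
  oplusxN0 : forall x, oplus x (mvneg mv0) = mvneg mv0;
  mv_luk : forall x y,
    oplus (mvneg (oplus (mvneg x) y)) y = oplus (mvneg (oplus (mvneg y) x)) x
}.

Arguments mv0 {_}.

Definition ominus (A : mvAlgebra) (x y : A) : A := mvneg (oplus (mvneg x) y).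

Notation "0" := mv0 : mv_scope.
Notation "x ⊕ y" := (oplus x y) (at level 50, left associativity) : mv_scope.
Notation "x ⊖ y" := (ominus x y) (at level 50, left associativity) : mv_scope.

Section MVWRigAxioms.
Local Open Scope mv_scope.
Variables (A : mvAlgebra) (mul : A -> A -> A).
Local Notation "x * y" := (mul x y) : mv_scope.

Definition mvw_absorbing : Prop := forall a : A, a * 0 = 0 /\ 0 * a = 0.

Definition mvw_subdistributive : Prop :=
  forall a b c : A, (a * (b ⊕ c)) ⊖ (a * b ⊕ a * c) = 0.

Definition mvw_difference : Prop :=
  forall a b c : A, (a * b ⊖ a * c) ⊖ (a * (b ⊖ c)) = 0.

End MVWRigAxioms.

(* Main.v *)
Require Import Defs.
From mathcomp Require Import all_boot zify.

(** Both models live on finite Łukasiewicz chains [0 < 1 < ... < n], where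
    [x ⊖ y] is truncated subtraction, so that [x ⊖ y = 0] means [x <= y].

    Independence of the difference axiom.  If [c <= b] then [b = c ⊕ (b ⊖ c)],
    and subdistributivity gives [ab <= ac ⊕ a(b ⊖ c)], which is the difference
    axiom at [a, b, c].  On a chain a counterexample must therefore have [b < c];
    then [b ⊖ c = 0], and under absorption what has to fail is the monotonicity
    of [x |-> ax].  On the chain [0 < 1 < 2] set [1 * 1 = 1] and all other
    products equal to [0].  A triple product is nonzero only on [(1, 1, 1)],
    whence associativity.  Subdistributivity survives because [1] is not a sum of
    two elements different from [1]: if [a(b ⊕ c)] is nonzero, then
    [a = b ⊕ c = 1], so [1] is one of [b] and [c], and [ab ⊕ ac >= 1].  Finally
    [1 * 1 = 1 > 0 = 1 * 2] shows that [x |-> 1 * x] is not monotone.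

    Independence of absorption.  If every product is the top element, then the
    right-hand sides [ab ⊕ ac] and [a(b ⊖ c)] of the two other inequalities are
    the top, so both hold; but [a * 0 = 0] fails unless the chain is trivial. *)

(** * Finite Łukasiewicz chains *)

Section LukasiewiczChain.
Variable n : nat.
Implicit Types x y z : 'I_n.+1.

Definition chain_add x y : 'I_n.+1 := inord (minn (x + y) n).
Definition chain_neg x : 'I_n.+1 := rev_ord x.

Lemma val_chain_add x y : val (chain_add x y) = minn (x + y) n.
Proof. by rewrite /chain_add /= inordK // ltnS geq_minr. Qed.

Lemma val_chain_neg x : val (chain_neg x) = n - x.
Proof. by rewrite /= subSS. Qed.

Let valE := (val_chain_add, val_chain_neg).

Lemma chain_addA : associative chain_add.
Proof. by move=> x y z; apply: val_inj; rewrite !valE; lia. Qed.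

Lemma chain_addC : commutative chain_add.
Proof. by move=> x y; apply: val_inj; rewrite !valE addnC. Qed.

Lemma chain_add0x : left_id ord0 chain_add.
Proof.
by move=> x; apply: val_inj; rewrite !valE /=; have := ltn_ord x; lia.
Qed.

Lemma chain_negK : involutive chain_neg.
Proof. exact: rev_ordK. Qed.

Lemma chain_addxN0 x : chain_add x (chain_neg ord0) = chain_neg ord0.
Proof. by apply: val_inj; rewrite !valE /=; lia. Qed.

(** Both sides are the maximum of [x] and [y]. *)
Lemma chain_luk x y :
  chain_add (chain_neg (chain_add (chain_neg x) y)) y =
  chain_add (chain_neg (chain_add (chain_neg y) x)) x.
Proof.
apply: val_inj; rewrite !valE.
by have := ltn_ord x; have := ltn_ord y; lia.
Qed.

Definition chain : mvAlgebra :=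
  MVAlgebra chain_addA chain_addC chain_add0x chain_negK chain_addxN0 chain_luk.

Lemma val_ominus x y : val (ominus (x : chain) y) = x - y.
Proof. by rewrite !valE; have := ltn_ord x; lia. Qed.

Lemma ominus_eq0 (x y : chain) : ominus x y = mv0 <-> val x <= val y.
Proof.
split=> [/(congr1 val) | le_xy].
  by rewrite val_ominus /= => /eqP.
by apply: val_inj; rewrite val_ominus; apply/eqP.
Qed.

End LukasiewiczChain.

(** * Independence of the difference axiom *)

Definition mid : chain 2 := inord 1.

Lemma val_mid : val mid = 1.
Proof. by rewrite /= inordK. Qed.

Definition mid_mul (x y : chain 2) : chain 2 :=
  if (val x == 1) && (val y == 1) then mid else mv0.

Lemma val_mid_mul x y : val (mid_mul x y) = (val x == 1) && (val y == 1).
Proof. by rewrite /mid_mul; case: ifP => // _; rewrite val_mid. Qed.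

Lemma mid_mulA : associative mid_mul.
Proof.
by move=> x y z; apply: val_inj; rewrite !val_mid_mul !eqb1 andbA.
Qed.

Lemma mid_mulC : commutative mid_mul.
Proof. by move=> x y; rewrite /mid_mul andbC. Qed.

Lemma mid_mul_absorbing : mvw_absorbing mid_mul.
Proof. by move=> a; rewrite [mid_mul mv0 a]mid_mulC /mid_mul andbF. Qed.

Lemma mid_mul_subdistributive : mvw_subdistributive mid_mul.
Proof.
move=> a b c; apply/ominus_eq0.
by rewrite val_chain_add !val_mid_mul val_chain_add /=; lia.
Qed.

Lemma mid_mul_not_difference : ~ mvw_difference mid_mul.
Proof.
(* The instance [a, b, c := 1, 1, 2] reads [1 - 0 <= 1 * 0 = 0]. *)
move=> /(_ mid mid ord_max) /ominus_eq0.
by rewrite val_ominus !val_mid_mul val_ominus !val_mid; exact: notF.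
Qed.

(** * Independence of the absorption axiom *)

Section TopProduct.
Variable n : nat.

Definition top_mul (x y : chain n) : chain n := mvneg mv0.

Lemma val_top_mul x y : val (top_mul x y) = n.
Proof. by rewrite /top_mul val_chain_neg subn0. Qed.

Lemma le_top_mul (x y z : chain n) : ominus z (top_mul x y) = mv0.
Proof. by apply/ominus_eq0; rewrite val_top_mul -ltnS ltn_ord. Qed.

Lemma top_mul_subdistributive : mvw_subdistributive top_mul.
Proof.
move=> a b c; apply/ominus_eq0.
by rewrite val_chain_add !val_top_mul leq_min leq_addr leqnn.
Qed.

Lemma top_mul_difference : mvw_difference top_mul.
Proof. by move=> a b c; apply: le_top_mul. Qed.

Lemma top_mul_not_absorbing : 0 < n -> ~ mvw_absorbing top_mul.
Proof.
by move=> n_gt0 /(_ mv0) [/(congr1 val)]; rewrite val_top_mul /=; lia.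
Qed.

End TopProduct.

Theorem proposition3p3 :
  (exists (A : mvAlgebra) (mul : A -> A -> A),
      associative mul /\ commutative mul /\
      mvw_absorbing mul /\ mvw_subdistributive mul /\ ~ mvw_difference mul)
  /\
  (exists (A : mvAlgebra) (mul : A -> A -> A),
      associative mul /\ commutative mul /\
      mvw_subdistributive mul /\ mvw_difference mul /\ ~ mvw_absorbing mul).
Proof.
split.
  exists (chain 2), mid_mul.
  exact: (conj mid_mulA (conj mid_mulC (conj mid_mul_absorbing
           (conj mid_mul_subdistributive mid_mul_not_difference)))).
exists (chain 1), (@top_mul 1); split; first by [].
split; first by [].
split; first exact: top_mul_subdistributive.
by split; [exact: top_mul_difference | exact: top_mul_not_absorbing].
Qed.
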